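(* Let $\{\boldsymbol Z_n\}_{n\ge0}$ be a block lower Hessenberg branching process with type set $\mathcal{X}_d$, and let $A\subseteq\mathcal{X}_d$. If $\{\boldsymbol Z_n\}$ is irreducible, then $\boldsymbol q(A)\le\tilde{\boldsymbol q}$ (entrywise), and if in addition $|A|<\infty$, then $\boldsymbol q(A)=\tilde{\boldsymbol q}$.
   Context: Fix an integer $1\le d<\infty$ and let $\mathcal{X}_d=\{\langle k,i\rangle: k\ge 0,\ 1\le i\le d\}$ (type $\langle k,i\rangle$ is in level $k$). A block lower Hessenberg branching process is a multitype Galton–Watson process $\{\boldsymbol Z_n\}_{n\ge0}$, $\boldsymbol Z_n=(Z_{n,j})_{j\in\mathcal{X}_d}$ (number of type-$j$ individuals in generation $n$), started from one individual of type $\varphi_0$, in which each individual lives one generation and, independently of all others, an individual of type $j$ produces offspring vector $\boldsymbol r=(r_l)_{l\in\mathcal{X}_d}$ with probability $p_j(\boldsymbol r)$, where for $j$ in level $k$ the distribution $p_j$ is concentrated on vectors with $r_l=0$ for all $l$ in levels larger than $k+1$. $\mathbb P_i=\mathbb P(\cdot\mid\varphi_0=i)$. With $M(i,j)$ the expected number of type-$j$ children of a type-$i$ individual, the process is irreducible if in the directed graph on $\mathcal{X}_d$ with an edge $i\to j$ iff $M(i,j)>0$ there is a path between any two vertices. $q_i(A)=\mathbb P_i(\exists n:\sum_{m\ge n}\sum_{j\in A}Z_{m,j}=0)$ is the probability of eventual extinction in $A$, $\boldsymbol q(A)=(q_i(A))_{i\in\mathcal{X}_d}$; $\tilde q_i=\mathbb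 P_i(\lim_nZ_{n,j}=0\ \forall j\in\mathcal{X}_d)$ defines the partial extinction probability vector $\tilde{\boldsymbol q}$.
   Formalization: The set A is assumed nonempty: for A empty one has q(A)=1, while the partial extinction probability can be 0 for an irreducible process, so the claim as stated fails in that case. *)

(* Defs.v *)
From HB Require Import structures.
From mathcomp Require Import all_boot all_order all_algebra.
From mathcomp Require Import all_classical all_reals all_analysis.

Set Implicit Arguments.
Unset Strict Implicit.
Unset Printing Implicit Defensive.

Import Order.TTheory GRing.Theory Num.Theory.
Import numFieldNormedType.Exports.

Local Open Scope classical_set_scope.
Local Open Scope ring_scope.

(** The type [<k, i>] (level [k >= 0], [1 <= i <= d]) is the pair [(k, i - 1)]. *)
Definition types (d : nat) := (nat * 'I_d)%type.

Definition level (d : nat) (j : types d) : nat := j.1.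

(** [r l] is the number of children of type [l]. *)
Definition offspring (d : nat) := types d -> nat.

Record offspring_law (R : realType) (d : nat)
    (p : types d -> offspring d -> R) : Prop := OffspringLaw {
  offspring_law_ge0 : forall j r, 0 <= p j r ;
  offspring_law_sum1 : forall j,
    (\esum_(r in [set: offspring d]) (p j r)%:E = 1)%E }.

Definition block_lower_Hessenberg (R : realType) (d : nat)
    (p : types d -> offspring d -> R) : Prop :=
  forall (j : types d) (r : offspring d), p j r != 0 ->
  forall l : types d, (level j + 1 < level l)%N -> r l = 0%N.

(** Mean offspring numbers may be infinite. *)
Definition mean_offspring (R : realType) (d : nat)
    (p : types d -> offspring d -> R) (i j : types d) : \bar R :=
  (\esum_(r in [set: offspring d]) ((r j)%:R * p i r)%:E)%E.

Definition mean_edge (R : realType) (d : nat)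
    (p : types d -> offspring d -> R) : rel (types d) :=
  fun i j => (0 < mean_offspring p i j)%E.

Definition irreducible_process (R : realType) (d : nat)
    (p : types d -> offspring d -> R) : Prop :=
  forall i j : types d,
  exists s : seq (types d), path (mean_edge p) i s /\ last i s = j.

(** [(n, j, k)] stands for the [k]-th (from [0]) individual of type [j] in
    generation [n]; it is actually born iff [k < Z n j]. *)
Definition individual (d : nat) := (nat * types d * nat)%type.

Definition individual_type (d : nat) (x : individual d) : types d := x.1.2.

(** [P i] is the law of the process conditioned on [phi0 = i], and [xi x] is
    the offspring vector of the individual [x].  Since the offspring vectors
    have discrete laws, independence is the product rule on point events.
    The evolution equation is stated in [\bar R], the sum over the parent
    types being infinite; it only has to hold almost surely because [xi] may
    leave the support of its law on a null set. *)
Record galton_watson (R : realType) (d : nat)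
    (p : types d -> offspring d -> R)
    (disp : measure_display) (T : measurableType disp)
    (P : types d -> probability T R)
    (phi0 : T -> types d)
    (xi : individual d -> T -> offspring d)
    (Z : nat -> types d -> T -> nat) : Prop := GaltonWatson {
  gw_measurable_phi0 : forall i, measurable [set w | phi0 w = i] ;
  gw_measurable_xi : forall x l, measurable_fun [set: T] (fun w => xi x w l) ;
  gw_measurable_Z : forall n j, measurable_fun [set: T] (Z n j) ;
  gw_start : forall i, P i [set w | phi0 w = i] = 1%E ;
  gw_law : forall i x r,
    P i [set w | xi x w = r] = (p (individual_type x) r)%:E ;
  gw_indep : forall i (s : seq (individual d)) (r : individual d -> offspring d),
    uniq s ->
    (P i (\bigcap_(x in [set` s]) [set w | xi x w = r x]) =
     \prod_(x <- s) P i [set w | xi x w = r x])%E ;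
  gw_init : forall i, {ae P i, forall w, forall j, Z 0%N j w = (j == phi0 w)} ;
  gw_evolution : forall i, {ae P i, forall w, forall n l,
    (((Z n.+1 l w)%:R)%:E =
     \esum_(j in [set: types d])
       (\sum_(k < Z n j w) (xi (n, j, k : nat) w l)%:R)%:E
       :> \bar R)%E} }.

Definition extinction_prob (R : realType) (d : nat)
    (disp : measure_display) (T : measurableType disp)
    (P : types d -> probability T R) (Z : nat -> types d -> T -> nat)
    (A : set (types d)) (i : types d) : \bar R :=
  P i [set w | exists n : nat,
    (\sum_(n <= m <oo) \esum_(j in A) ((Z m j w)%:R)%:E = 0 :> \bar R)%E].

Definition partial_extinction_prob (R : realType) (d : nat)
    (disp : measure_display) (T : measurableType disp)
    (P : types d -> probability T R) (Z : nat -> types d -> T -> nat)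
    (i : types d) : \bar R :=
  P i [set w | forall j : types d,
    (fun n => (Z n j w)%:R : R) @ \oo --> (0 : R)].

(* Main.v *)
(** If there is an edge from [i] to [j], some offspring vector [r] with
    [r j > 0] has probability [c > 0] for a parent of type [i].  Fix [a]; let
    [S n] be the event that type [i] is present in generation [n] but that in
    no generation [m] with [a <= m < n] did the first individual of type [i]
    produce [r].  Whether [S n] occurs depends only on the individuals born
    before generation [n], hence is independent of the offspring of the first
    type-[i] individual of generation [n].  So [c * P (S n)] is the probability
    that [r] is first produced in generation [n]; these events are disjoint,
    [\sum_n P (S n)] is finite, and by Borel-Cantelli almost surely only
    finitely many [S n] occur: if [i] is present infinitely often, then so is
    [j].  Chaining along paths, almost surely either all types are present
    infinitely often or none is. *)
Require Import Defs.
From HB Require Import structures.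
From mathcomp Require Import all_boot all_order all_algebra.
From mathcomp Require Import all_classical all_reals all_analysis.
From mathcomp Require Import zify.

Set Implicit Arguments.
Unset Strict Implicit.
Unset Printing Implicit Defensive.

Import Order.TTheory GRing.Theory Num.Theory.
Import numFieldNormedType.Exports.

Local Open Scope classical_set_scope.
Local Open Scope ring_scope.

(** * Almost sure statements and discrete random variables *)

Section AlmostSure.
Context {R : realType} {disp : measure_display} {T : measurableType disp}.
Variable mu : probability T R.

Lemma ae_forall_countType (I : countType) (Q : I -> T -> Prop) :
  (forall i, {ae mu, forall w, Q i w}) -> {ae mu, forall w, forall i, Q i w}.
Proof.
move=> aeQ; have aen (n : nat) :
    {ae mu, forall w, if unpickle n is Some i then Q i w else True}.
  case: (unpickle n : option I) => [i|]; first exact: aeQ.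
  by apply: filterE.
apply: filterS (ae_foralln aen) => w Qw i.
by have := Qw (pickle i); rewrite pickleK.
Qed.

Lemma measureI_full (A B : set T) : measurable A -> measurable B ->
  mu A = 0%E -> mu (B `&` ~` A) = mu B.
Proof.
move=> mA mB A0; have mBA := measurableI _ _ mB (measurableC mA).
rewrite -[in RHS](setUIDK B A) setUC (measureU0 (mu := mu) mBA) //.
  exact: measurableI.
apply: (subset_measure0 (B := A)) => //; exact: measurableI.
Qed.

Lemma indep_bigcup (E : nat -> set T) (C : set T) (c : R) :
  (forall n, measurable (E n)) -> measurable C -> trivIset setT E ->
  (forall n, mu (E n `&` C) = c%:E * mu (E n))%E ->
  (mu (\bigcup_n E n `&` C) = c%:E * mu (\bigcup_n E n))%E.
Proof.
move=> mE mC tE EC; rewrite setI_bigcupl.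
rewrite (measure_bigcup mu) => [|n _|]; last 2 first.
- exact: measurableI.
- exact: trivIset_setIr.
rewrite (measure_bigcup mu) // -nneseriesZl //.
by apply: eq_eseriesr => n _; exact: EC.
Qed.

(** [I] may be uncountable, as [offspring d] is, so null sets cannot be summed over all values. The
    infinite sum is a supremum of finite ones: there are finite sets of mass above [1 - 1/(n+1)],
    and their union carries [X] almost surely. *)
Lemma ae_countable_support (I : choiceType) (X : T -> I) (q : I -> R) :
  (forall r, measurable [set w | X w = r]) ->
  (forall r, 0 <= q r) ->
  (forall r, mu [set w | X w = r] = (q r)%:E) ->
  (\esum_(r in [set: I]) (q r)%:E = 1)%E ->
  exists F : set I, countable F /\ {ae mu, forall w, F (X w) /\ q (X w) != 0}.
Proof.
move=> mX q0 Xq sum1.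
have /choice[D HD] (n : nat) : exists D : set I,
    [/\ finite_set D, D `<=` [set r | q r != 0] &
        ((1 - n.+1%:R^-1)%:E < mu (\bigcup_(r in D) [set w | X w = r]))%E].
  have lt1 : ((1 - n.+1%:R^-1)%:E < \esum_(r in [set: I]) (q r)%:E)%E.
    by rewrite sum1 lte_fin ltrBlDr ltrDl invr_gt0 ltr0n.
  have /ereal_sup_gt[_ [D [finD _] <-] ltD] := lt1.
  (* Dropping the values of weight zero keeps the mass and will give [q (X w) != 0]. *)
  exists (D `&` [set r | q r != 0]); split; [exact: finite_setIl|by move=> r []|].
  rewrite measure_fin_bigcup //; first last.
  - by move=> r s _ _ [w [/= <- <-]].
  - exact: finite_setIl.
  rewrite (eq_fsbigr (fun r => (q r)%:E)); last by move=> r _; exact: Xq.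
  rewrite (fsbig_widen _ D) //.
  by move=> r [Dr /= /not_andP[//|/negP/negPn/eqP ->]].
exists (\bigcup_n D n); split.
  by apply: bigcup_countable => // n _; apply: finite_set_countable; have [] := HD n.
pose B n := \bigcup_(r in D n) [set w | X w = r].
have mB n : measurable (B n).
  by apply: fin_bigcup_measurable => //; have [] := HD n.
exists (\bigcap_n ~` B n); split.
- by apply: bigcap_measurable => // n _; exact: measurableC.
- apply/eqP; rewrite eq_le measure_ge0 andbT; apply/lee_addgt0Pr => e e0.
  rewrite add0e; have [n en] : exists n : nat, n.+1%:R^-1 < e.
    by exists (Num.truncn e^-1); rewrite invf_plt ?posrE // truncnS_gt.
  apply: (@le_trans _ _ (mu (~` B n))).
    rewrite le_measure ?inE //; first by apply: bigcap_measurable => // k _; exact: measurableC.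
      exact: measurableC.
    by move=> w; apply.
  rewrite probability_setC //; have [_ _ /ltW] := HD n.
  rewrite -/(B n) => le; rewrite leeBlDr ?fin_num_measure //.
  apply: (le_trans _ (leeD2l e%:E le)); rewrite -EFinD lee_fin.
  by rewrite addrCA lerDl subr_ge0 ltW.
- move=> w; apply: contra_notP => /= /existsNP[n].
  move=> /not_implyP[_ /contrapT[r Dr /= Xr]]; rewrite Xr.
  by split; [exists n|have [_ + _] := HD n; apply].
Qed.

End AlmostSure.

(** * Deterministic sample paths *)

Section Trajectories.
Context {R : realType} {d : nat}.
Variables (p : types d -> offspring d -> R) (F : set (offspring d)).
Hypothesis p_Hessenberg : block_lower_Hessenberg p.
Variable i0 : types d.

(** A sample path off the null sets: each offspring vector has nonzero probability, so it obeys the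
    Hessenberg condition, and lies in a set [F], later countable, whose elements can be coded by
    integers. *)
Definition trajectory (x : individual d -> offspring d)
    (z : nat -> types d -> nat) : Prop :=
  [/\ forall y, F (x y) /\ p (individual_type y) (x y) != 0,
      forall j, z 0%N j = (j == i0) &
      forall n l, (((z n.+1 l)%:R)%:E =
        \esum_(j in [set: types d])
          (\sum_(k < z n j) (x (n, j, k : nat) l)%:R)%:E :> \bar R)%E].

Lemma trajectory_level x z n j :
  trajectory x z -> (level i0 + n < level j)%N -> z n j = 0%N.
Proof.
move=> [xF z0 zS]; elim: n j => [|n IHn] j ltj.
  by rewrite z0; case: eqP ltj => // ->; lia.
have := zS n j; rewrite esum1 => [[] /eqP|l _]; first by rewrite pnatr_eq0 => /eqP.
rewrite big1 // => k _; have [ltl|lel] := ltnP (level i0 + n) (level l).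
  by case: k => k; rewrite IHn.
by rewrite (p_Hessenberg (xF (n, l, k : nat)).2) //= /individual_type /=; lia.
Qed.

Definition types_upto (m : nat) : seq (types d) :=
  [seq (k, i) | k <- iota 0 m.+1, i <- enum 'I_d].

Lemma mem_types_upto m j : (j \in types_upto m) = (level j <= m)%N.
Proof.
case: j => k i; apply/allpairsP/idP => [[[k' i'] [+ _ [-> _]]]|lekm].
  by rewrite mem_iota.
by exists (k, i); rewrite mem_iota mem_enum.
Qed.

(* By the Hessenberg condition, generation [m] has no type above level
   [level i0 + m], so these finitely many individuals are all that are born
   before generation [n]. *)
Definition born_before (z : nat -> types d -> nat) (n : nat) :
    seq (individual d) :=
  undup [seq (mj, k) | mj <- [seq (m, j) | m <- iota 0 n,
                                 j <- types_upto (level i0 + m)],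
                       k <- iota 0 (z mj.1 mj.2)].

Lemma mem_born_before z n m j k :
  ((m, j, k) \in born_before z n) =
    [&& (m < n)%N, (level j <= level i0 + m)%N & (k < z m j)%N].
Proof.
rewrite mem_undup; apply/allpairsPdep/and3P => [[mj [k' [+ + []]]]|[ltm lej ltk]].
  move=> + + e; rewrite -{mj}e => /allpairsPdep[m' [j' [+ + [-> ->]]]] /= + ->.
  by rewrite !mem_iota mem_types_upto.
exists (m, j), k; split=> //; last by rewrite mem_iota.
by apply/allpairsPdep; exists m, j; rewrite mem_iota mem_types_upto.
Qed.

(** The step from generation [m] to [m.+1] reads only the offspring of individuals with [k < z m j];
    by the level bound they all occur in [born_before z n]. *)
Lemma trajectory_agree x z x' z' n :
  trajectory x z -> trajectory x' z' ->
  {in born_before z n, x' =1 x} ->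
  forall m, (m <= n)%N -> z' m =1 z m.
Proof.
move=> tz tz' xx'; have [_ z0 zS] := tz; have [_ z'0 z'S] := tz'.
elim=> [|m IHm] lemn l; first by rewrite z0 z'0.
have /eqP := z'S m l; rewrite (_ : (\esum_(j in _) _)%E = (z m.+1 l)%:R%:E).
  by rewrite eqe eqr_nat => /eqP.
rewrite zS; apply: eq_esum => j _; rewrite IHm 1?ltnW //; congr (_%:E).
apply: eq_bigr => k _; congr (_%:R); rewrite xx' // mem_born_before lemn ltn_ord andbT /=.
by rewrite leqNgt; apply/negP => /(trajectory_level tz); case: k => k /= + z0m; rewrite z0m.
Qed.

Lemma eq_born_before z z' n :
  (forall m, (m < n)%N -> z' m =1 z m) -> born_before z' n = born_before z n.
Proof.
move=> zz'; congr undup; congr flatten; apply/eq_in_map => -[m j].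
by case/allpairsPdep => m' [j' [+ _ [-> _]]]; rewrite mem_iota => /zz' ->.
Qed.

Lemma trajectory_child x z n j l :
  trajectory x z -> (0 < z n j)%N -> (0 < x (n, j, 0%N) l)%N ->
  (0 < z n.+1 l)%N.
Proof.
move=> [_ _ zS] zj xl; have := zS n l; case: (z n.+1 l) => // /esym/eqP.
rewrite eq_le => /andP[+ _]; apply: contraTT => _; rewrite -ltNge.
apply: (@lt_le_trans _ _ (\sum_(k < z n j) (x (n, j, k : nat) l)%:R)%:E).
  by rewrite lte_fin -natr_sum ltr0n (bigD1 (Ordinal zj)) //= addn_gt0 xl.
apply: esum_ge; exists [set j]; first by split.
by rewrite fsbig_set1.
Qed.

End Trajectories.

Lemma mean_edge_offspring (R : realType) (d : nat)
    (p : types d -> offspring d -> R) (i j : types d) :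
  offspring_law p -> mean_edge p i j -> exists r, 0 < p i r /\ (0 < r j)%N.
Proof.
move=> [p0 _]; apply: contraPP => /forallNP noR; rewrite /mean_edge /mean_offspring.
rewrite esum1 ?ltxx // => r _; have /not_andP[/negP|/negP] := noR r.
  by rewrite lt0r p0 andbT negbK => /eqP ->; rewrite mulr0.
by rewrite -eqn0Ngt => /eqP ->; rewrite mul0r.
Qed.

(** * Measurability of countably described events *)

Section MeasurableEvents.
Context {disp : measure_display} {T : measurableType disp}.

Lemma measurable_nat_event (f : T -> nat) (Y : set nat) :
  measurable_fun setT f -> measurable [set w | Y (f w)].
Proof. by move=> mf; rewrite -[X in measurable X]setTI; apply: mf. Qed.

Lemma measurable_forall_countType (I : countType) (Q : I -> set T) :
  (forall i, measurable (Q i)) -> measurable [set w | forall i, Q i w].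
Proof.
move=> mQ; rewrite (_ : [set w | _] = ~` \bigcup_i ~` Q i).
  apply/measurableC/countable_bigcupT_measurable; first exact: countableP.
  by move=> i; exact: measurableC.
apply/seteqP; split=> [w Qw [i _]|w Qw i]; first by apply; exact: Qw.
by apply: contrapT => nQ; apply: Qw; exists i.
Qed.

End MeasurableEvents.

(** * The random process and its sample paths *)

Section Process.
Context {R : realType} {d : nat} {p : types d -> offspring d -> R}.
Hypotheses (p_law : offspring_law p) (p_Hessenberg : block_lower_Hessenberg p).
Context {disp : measure_display} {T : measurableType disp}
  {P : types d -> probability T R} {phi0 : T -> types d}
  {xi : individual d -> T -> offspring d} {Z : nat -> types d -> T -> nat}.
Hypothesis Z_process : galton_watson p P phi0 xi Z.
Variable i0 : types d.

Lemma measurable_xi_event y r : measurable [set w | xi y w = r].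
Proof.
rewrite (_ : [set w | _] = [set w | forall l, [set w | xi y w l = r l] w]).
  apply: measurable_forall_countType => l.
  exact: (measurable_nat_event (eq^~ (r l))) (gw_measurable_xi Z_process y l).
by apply/seteqP; split=> [w /= -> //|w /= xr]; apply/funext.
Qed.

Lemma ae_trajectory : exists F : set (offspring d), countable F /\
  {ae P i0, forall w, trajectory p F i0 (xi^~ w) (fun n j => Z n j w)}.
Proof.
have /choice[F HF] (y : individual d) : exists F : set (offspring d),
    countable F /\
    {ae P i0, forall w, F (xi y w) /\ p (individual_type y) (xi y w) != 0}.
  apply: ae_countable_support.
  - exact: measurable_xi_event.
  - exact: offspring_law_ge0.
  - exact: gw_law Z_process i0 y.
  - exact: offspring_law_sum1.
(* There are countably many individuals, so one countable set serves them all. *)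
exists (\bigcup_y F y); split.
  by apply: bigcup_countable => [|y _]; [exact: countableP|have [] := HF y].
have phi_i0 : {ae P i0, forall w, phi0 w = i0}.
  have mphi := gw_measurable_phi0 Z_process i0.
  exists (~` [set w | phi0 w = i0]); split=> //; first exact: measurableC.
  by rewrite probability_setC // (gw_start Z_process) subee.
have xiF : {ae P i0, forall w y,
    F y (xi y w) /\ p (individual_type y) (xi y w) != 0}.
  by apply: ae_forall_countType => y; have [] := HF y.
have Z0 := gw_init Z_process i0; have ZS := gw_evolution Z_process i0.
apply: filterS (filterI (filterI phi_i0 xiF) (filterI Z0 ZS)).
move=> w [[phiw xiw] [Z0w ZSw]]; split=> [y|j|//].
  by have [Fy py] := xiw y; split=> //; exists y.
by rewrite Z0w phiw.
Qed.

(** * Independence of the past and of the newly born *)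

(** Pathwise form of measurability with respect to the history before generation [n]. One
    implication is enough: between trajectories, under the Hessenberg condition, the agreement is
    symmetric in [w] and [w']. *)
Definition determined_before (F : set (offspring d)) (n : nat) (S : set T) :=
  forall w w',
    trajectory p F i0 (xi^~ w) (fun n j => Z n j w) ->
    trajectory p F i0 (xi^~ w') (fun n j => Z n j w') ->
    {in born_before i0 (fun n j => Z n j w) n, xi^~ w' =1 xi^~ w} ->
    S w -> S w'.

Lemma cylinder_indep (s : seq (individual d)) y (x : individual d -> offspring d) r :
  uniq s -> y \notin s ->
  (P i0 (\bigcap_(y' in [set` s]) [set w | xi y' w = x y'] `&`
         [set w | xi y w = r]) =
   (p (individual_type y) r)%:E *
     P i0 (\bigcap_(y' in [set` s]) [set w | xi y' w = x y']))%E.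
Proof.
(* [x'] prescribes [r] at [y] and [x] on [s], so the product rule for [y :: s] covers both
   events. *)
move=> us ys; pose x' y' := if y' == y then r else x y'.
have xx' : {in s, x' =1 x}.
  by move=> y' y's; rewrite /x'; case: eqP => // yy; rewrite yy (negPf ys) in y's.
have := gw_indep Z_process (i0) (s := y :: s) x'; rewrite /= ys us => /(_ isT).
have x'y : x' y = r by rewrite /x' eqxx.
rewrite big_cons (gw_law Z_process) x'y.
have -> : (\prod_(y' <- s) P i0 [set w | xi y' w = x' y'] =
    P i0 (\bigcap_(y' in [set` s]) [set w | xi y' w = x y']))%E.
  rewrite -(gw_indep Z_process) //; congr (P i0 _).
  by apply: eq_bigcapr => y' /= /xx' ->.
move=> <-; congr (P i0 _); apply/seteqP; split=> [w [sw yw] y' /=|w sw].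
  by rewrite inE /x'; case: eqP => [-> _ //|_ /= /sw].
split; last by rewrite /= -x'y; apply: sw; rewrite /= mem_head.
by move=> y' /= y's; rewrite -xx' //; apply: sw; rewrite /= inE y's orbT.
Qed.

Lemma indep_history F n j k r S :
  countable F ->
  {ae P i0, forall w, trajectory p F i0 (xi^~ w) (fun n j => Z n j w)} ->
  measurable S -> determined_before F n S ->
  (P i0 (S `&` [set w | xi (n, j, k) w = r]) = (p j r)%:E * P i0 S)%E.
Proof.
move=> /countable_injP[e e_inj] [A [mA A0 trajA]] mS detS.
set C := [set w | _]; have mC : measurable C := measurable_xi_event _ _.
have traj w : (~` A) w -> trajectory p F i0 (xi^~ w) (fun n j => Z n j w).
  by move=> Aw; apply: contrapT => /trajA.
(* The offspring vectors, coded by [e], of the individuals born before [n]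
   take countably many values, and [E v] is a.s. empty or a cylinder. *)
pose born w := born_before i0 (fun n j => Z n j w) n.
pose hist w := [seq (y, e (xi y w)) | y <- born w].
pose E v := S `&` ~` A `&` [set w | pickle (hist w) = v].
pose cyl w0 := \bigcap_(y in [set` born w0]) [set w | xi y w = xi y w0].
have mcyl w0 : measurable (cyl w0).
  by apply: fin_bigcap_measurable => // y _; exact: measurable_xi_event.
(* Equal codes mean the same individuals born and, [e] being injective on [F], the same offspring.
   Conversely, a trajectory in the cylinder has the born list and the code of [w0], and [detS]
   carries [S] over. *)
have Ecyl v w0 : E v w0 -> E v = cyl w0 `&` ~` A.
  move=> [[Sw0 Aw0] <-]; apply/seteqP; split=> w /=.
    move=> [[Sw Aw] /= /(pcan_inj pickleK) hw]; split=> // y /= yw0.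
    have : (y, e (xi y w0)) \in hist w by rewrite hw; apply: map_f.
    move=> /mapP[y' _ [<-]] /e_inj -> //; rewrite inE.
      by have [/(_ y)[]] := traj _ Aw0.
    by have [/(_ y)[]] := traj _ Aw.
  move=> [cw Aw].
  have agree : {in born w0, xi^~ w =1 xi^~ w0} by move=> y; exact: cw.
  have tw0 := traj _ Aw0; have tw := traj _ Aw.
  have bw : born w = born w0.
    apply: eq_born_before => m /ltnW.
    exact: (trajectory_agree p_Hessenberg tw0 tw agree).
  split; first by split=> //; exact: (detS w0 w).
  rewrite /= /hist bw; congr pickle; apply/eq_in_map => y yb.
  by rewrite agree.
have mE v : measurable (E v).
  have [[w0 /Ecyl ->]|/forallNP E0] := pselect (exists w0, E v w0).
    by apply: measurableI => //; exact: measurableC.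
  by rewrite (_ : E v = set0) //; apply/seteqP; split=> // w /E0.
have SE : S `&` ~` A = \bigcup_v E v.
  apply/seteqP; split=> [w Sw|w [v _ []]//].
  by exists (pickle (hist w)).
have mSC := measurableI _ _ mS mC.
rewrite -(measureI_full mA mSC A0) -(measureI_full mA mS A0) setIAC SE.
apply: indep_bigcup => //.
  by move=> v v' _ _ [w [[_ <-] [_ <-]]].
move=> v; have [[w0 /Ecyl ->]|/forallNP E0] := pselect (exists w0, E v w0); last first.
  rewrite (_ : E v = set0) ?set0I ?measure0 ?mule0 //.
  by apply/seteqP; split=> // w /E0.
rewrite setIAC !measureI_full //; last exact: measurableI.
apply: (cylinder_indep (xi^~ w0)); first exact: undup_uniq.
(* An individual of generation [n] is not born before [n], so the cylinder leaves its offspring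
   free. *)
by rewrite mem_born_before ltnn.
Qed.

(** * Recurrence passes along edges and paths *)

Definition recurrent (i : types d) (w : T) : Prop :=
  forall a : nat, exists2 n, (a <= n)%N & (0 < Z n i w)%N.

Lemma ae_recurrent_edge i j : mean_edge p i j ->
  {ae P i0, forall w, recurrent i w -> recurrent j w}.
Proof.
move=> /(mean_edge_offspring p_law)[r [pr rj]].
have [F [cF trajF]] := ae_trajectory.
pose visit n := [set w | (0 < Z n i w)%N].
pose hit n := [set w | xi (n, i, 0%N) w = r].
(* The start [a] stays free because recurrence of [j] asks for visits beyond every bound. *)
pose S a n := [set w | (a <= n)%N] `&` visit n `&`
  [set w | forall m, (~` ([set w | (a <= m < n)%N] `&` visit m `&` hit m)) w].
have mcst (b : bool) : measurable [set _ : T | b].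
  exact: (measurable_nat_event (fun=> b)) (measurable_cst 0%N).
have mvisit n : measurable (visit n).
  exact: (measurable_nat_event (fun v => (0 < v)%N)) (gw_measurable_Z Z_process n i).
have mhit n : measurable (hit n) by exact: measurable_xi_event.
have mS a n : measurable (S a n).
  apply: measurableI; first exact: measurableI.
  apply: measurable_forall_countType => m; apply: measurableC.
  by apply: measurableI => //; exact: measurableI.
have detS a n : determined_before F n (S a n).
  move=> w w' tw tw' agree [[lean visw] nohit].
  have ZZ := trajectory_agree p_Hessenberg tw tw' agree.
  split; first by split=> //; rewrite /visit /= ZZ.
  move=> m [[/andP[leam ltmn]]]; rewrite /visit /hit /= ZZ ?(ltnW ltmn) // => vm.
  rewrite agree => [hm|]; first by apply: (nohit m); rewrite /visit /hit /= leam ltmn.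
  rewrite mem_born_before ltmn vm andbT /= leqNgt; apply/negP.
  by move=> /(trajectory_level p_Hessenberg tw) Zm0; rewrite Zm0 in vm.
have Sio a : P i0 (lim_sup_set (S a)) = 0%E.
  apply: lim_sup_set_cvg0 => //.
  have mSh n : measurable (S a n `&` hit n) by exact: measurableI.
  (* The event of larger index excludes the hit recorded by the smaller one. *)
  have tSh : trivIset setT (fun n => S a n `&` hit n).
    move=> n m _ _ [w [[[[lan vn] nn] hn] [[[lam vm] nm] hm]]].
    have [ltnm|ltmn|//] := ltngtP n m.
      by case: (nm n); rewrite /= lan ltnm.
    by case: (nn m); rewrite /= lam ltmn.
  have : ((p i r)%:E * \sum_(0 <= n <oo) P i0 (S a n) <= 1)%E.
    rewrite -nneseriesZl // (eq_eseriesr (g := fun n => P i0 (S a n `&` hit n))).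
      have mU := bigcup_measurable (fun n _ => mSh n).
      by rewrite -measure_semi_bigcup // probability_le1.
    by move=> n _; rewrite -(indep_history i 0%N r cF trajF (mS a n) (detS a n)).
  (* As [p i r > 0], an infinite sum would give [+oo <= 1]. *)
  case: (\sum_(0 <= n <oo) _)%E => [x _||//]; first exact: ltry.
  by rewrite mulry gtr0_sg // mul1e.
have aeS : {ae P i0, forall w a, ~ lim_sup_set (S a) w}.
  apply: ae_forall_countType => a; exists (lim_sup_set (S a)); split=> //.
    apply: bigcap_measurable => // n _; exact: bigcup_measurable.
  by move=> w /contrapT.
apply: filterS2 trajF aeS => w tw nS reci a.
(* If [j] is absent from generation [a] on, no first individual of type [i] has produced [r] since
   [a], so each later visit to [i] realises [S a n]. *)
apply: contrapT => noj; apply: (nS a) => b _.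
have [n] := reci (maxn a b); rewrite geq_max => /andP[lean lebn] vn.
exists n => //; split=> // m [[/andP[leam _] vm] hm]; apply: noj.
exists m.+1; first exact: leqW.
by apply: (trajectory_child tw vm); rewrite hm.
Qed.

Lemma ae_recurrent_irreducible : irreducible_process p ->
  {ae P i0, forall w, forall i j, recurrent i w -> recurrent j w}.
Proof.
move=> irr.
(* A single null set for all pairs, so that paths of any length can be followed. *)
have edges : {ae P i0, forall w, forall ij : types d * types d,
    mean_edge p ij.1 ij.2 -> recurrent ij.1 w -> recurrent ij.2 w}.
  apply: ae_forall_countType => -[i j] /=.
  have [/ae_recurrent_edge|_] := boolP (mean_edge p i j); last exact: filterE.
  by move=> ae_ij; apply: filterS ae_ij => w + _; apply.
apply: filterS edges => w edge i j.
have [s [+ <-]] := irr i j; elim: s i => [|l s IHs] i //= /andP[il ls] reci.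
by apply: IHs => //; exact: (edge (i, l)).
Qed.

(** * Extinction in terms of vanishing populations *)

Lemma population_cvg0 j w :
  (fun n => (Z n j w)%:R : R) @ \oo --> (0 : R) <->
  exists n, forall m, (n <= m)%N -> Z m j w = 0%N.
Proof.
split=> [/cvgrPdist_lt/(_ 1 ltr01)[n _ Zn]|[n Zn]].
  (* A natural number at distance less than 1 from 0 is 0. *)
  exists n => m /Zn /=; rewrite sub0r normrN ger0_norm // ltrn1.
  by case: (Z m j w).
apply/cvgrPdist_lt => e e0; exists n => // m /= /Zn ->.
by rewrite subr0 normr0.
Qed.

Lemma population_series_eq0 (A : set (types d)) n w :
  (\sum_(n <= m <oo) \esum_(j in A) ((Z m j w)%:R)%:E = 0 :> \bar R)%E <->
  forall m j, (n <= m)%N -> A j -> Z m j w = 0%N.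
Proof.
have ge0 m : (0 <= \esum_(j in A) ((Z m j w)%:R)%:E :> \bar R)%E.
  by apply: esum_ge0 => j _; rewrite lee_fin.
split=> [sum0 m j lenm Aj|Z0]; last first.
  by apply: eseries0 => m lenm _; apply: esum1 => j Aj; rewrite Z0.
apply/eqP; rewrite -(@pnatr_eq0 R) -eqe eq_le; apply/andP; split;
  last by rewrite lee_fin.
apply: (@le_trans _ _ (\esum_(j in A) ((Z m j w)%:R)%:E)%E).
  apply: esum_ge; exists [set j]; first by split=> // _ ->.
  by rewrite fsbig_set1.
have := sum0; rewrite -[0%:E]/(0%E) => <-.
(* The partial sum up to [m.+1] is the first to contain the term of index [m]. *)
apply: le_trans (nneseries_lim_ge m.+1 _); last by [].
by rewrite big_nat_recr //= leeDr // sume_ge0.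
Qed.

End Process.

(** * Comparison of the two extinction probabilities *)

Theorem corollary1 (R : realType) (d : nat) (d_ge1 : (1 <= d)%N)
    (p : types d -> offspring d -> R)
    (p_law : offspring_law p)
    (p_Hessenberg : block_lower_Hessenberg p)
    (disp : measure_display) (T : measurableType disp)
    (P : types d -> probability T R)
    (phi0 : T -> types d)
    (xi : individual d -> T -> offspring d)
    (Z : nat -> types d -> T -> nat)
    (Z_process : galton_watson p P phi0 xi Z)
    (A : set (types d)) (A_neq0 : A !=set0)
    (p_irreducible : irreducible_process p) :
  (forall i : types d,
     (extinction_prob P Z A i <= partial_extinction_prob P Z i)%E) /\
  (finite_set A ->
   forall i : types d,
     extinction_prob P Z A i = partial_extinction_prob P Z i).
Proof.
rewrite /extinction_prob /partial_extinction_prob.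
set E := [set w | exists n, _]; set Q := [set w | forall j, _].
(* Written as a countable union of countable intersections, the event is visibly measurable. *)
have EE : E = \bigcup_n [set w | forall mj : nat * types d,
    [set w | (n <= mj.1)%N -> A mj.2 -> Z mj.1 mj.2 w = 0%N] w].
  apply/seteqP; split=> w /=.
    by move=> [n /population_series_eq0 Z0]; exists n => // -[m j] /=; exact: Z0.
  by move=> [n _ Z0]; exists n; apply/population_series_eq0 => m j; exact: (Z0 (m, j)).
have QE : Q = [set w | forall j, (\bigcup_n [set w | forall m,
    [set w | (n <= m)%N -> Z m j w = 0%N] w]) w].
  apply/seteqP; split=> w /= Qw j.
    by have /population_cvg0[n Zn] := Qw j; exists n.
  by have [n _ Zn] := Qw j; apply/population_cvg0; exists n.
have mZ (H : Prop) m j : measurable [set w | H -> Z m j w = 0%N].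
  exact: (measurable_nat_event (fun v => H -> v = 0%N)) (gw_measurable_Z Z_process m j).
have mE : measurable E.
  rewrite EE; apply: bigcup_measurable => n _.
  apply: measurable_forall_countType => -[m j] /=.
  have := mZ ((n <= m)%N /\ A j) m j; congr measurable.
  by apply/seteqP; split=> w /= Zw; [move=> ? ?; exact: Zw|move=> []; exact: Zw].
have mQ : measurable Q.
  rewrite QE; apply: measurable_forall_countType => j.
  apply: bigcup_measurable => n _; apply: measurable_forall_countType => m.
  exact: mZ.
have leEQ i : (P i E <= P i Q)%E.
  have [N [mN N0 recN]] :=
    ae_recurrent_irreducible p_law p_Hessenberg Z_process i p_irreducible.
  rewrite -(measureI_full mN mE N0).
  apply: le_measure; rewrite ?inE //; first exact/measurableI/measurableC.
  move=> w [[n /population_series_eq0 Zn] Nw] j; apply/population_cvg0.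
  have rec := contrapT (fun not_rec => Nw (recN w not_rec)).
  (* A type [j] that does not die out is recurrent, hence so is any [a] in [A], against extinction
     in [A]. *)
  apply: contrapT => /forallNP noext.
  have [a Aa] := A_neq0.
  have [b|m lenm] := rec j a _ n; last by rewrite Zn.
  have /existsNP[m /not_implyP[lebm /eqP Zm]] := noext b.
  by exists m => //; rewrite lt0n.
split=> // finA i; apply/eqP; rewrite eq_le leEQ /=.
apply: le_measure; rewrite ?inE // => w; rewrite QE => Qw.
have /choice[n Zn] : forall j, exists n, forall m, (n <= m)%N -> Z m j w = 0%N.
  by move=> j; have [n _ Zn] := Qw j; exists n.
have /finite_seqP[s As] := finA.
(* Finitely many types have a last extinction time, so the inclusion holds pointwise. *)
exists (\max_(j <- s) n j)%N; apply/population_series_eq0 => m j lem Aj.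
apply: Zn; apply: leq_trans lem.
by move: Aj; rewrite As => js; exact: leq_bigmax_seq.
Qed.
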